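(* Let $A$ be a Banach algebra. Then: (1) If $A^{***}A^{**}\subseteq A^{*}$, then $\tilde Z_1^\ell(A^{**})=Z_1(A^{**})=A^{**}$. (2) If $A^{**}A^{***}\subseteq A^{*}$, then $\tilde Z_1^r(A^{**})=A^{**}$.
   Context: The second dual $A^{**}$ carries the first Arens product: for $a,b\in A$, $a'\in A^*$, $a'',b''\in A^{**}$, $\langle a'a,b\rangle=\langle a',ab\rangle$, $\langle a''a',a\rangle=\langle a'',a'a\rangle$, $\langle a''b'',a'\rangle=\langle a'',b''a'\rangle$. The space $A^{***}=(A^{**})^*$ is a Banach $A^{**}$-bimodule by $\langle a'''a'',b''\rangle=\langle a''',a''b''\rangle$ and $\langle a''a''',b''\rangle=\langle a''',b''a''\rangle$. $A^*$ is identified with its canonical image in $A^{***}$. A product of two sets denotes the set of all products, e.g. $A^{***}A^{**}=\{a'''a'':a'''\in A^{***},a''\in A^{**}\}$. Definitions: $Z_1(A^{**})$ is the set of $a''\in A^{**}$ such that $b''\mapsto a''b''$ is weak*-to-weak* continuous on $A^{**}$; $\tilde Z_1^\ell(A^{**})$ is the set of $a''\in A^{**}$ such that $b''\mapsto a''b''$ is weak*-to-weak continuous on $A^{**}$; $\tilde Z_1^r(A^{**})$ is the set of $a''\in A^{**}$ such that $b''\mapsto b''a''$ is weak*-to-weak continuous on $A^{**}$. Here weak* means $\sigma(A^{**},A^* )$ and weak means $\sigma(A^{**},A^{***})$. *)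

(* Defs.v *)
From HB Require Import structures.
From mathcomp Require Import all_boot all_order all_algebra.
From mathcomp Require Import all_classical all_reals all_analysis.
From mathcomp Require Import complex.

Set Implicit Arguments.
Unset Strict Implicit.
Unset Printing Implicit Defensive.

Import Order.TTheory GRing.Theory Num.Theory.
Import numFieldNormedType.Exports.

Local Open Scope classical_set_scope.
Local Open Scope ring_scope.

Variant scalar_kind := RealScalars | ComplexScalars.

(* The ground field, either R or R[i]; norms take their values in the field
   itself, so that a norm over R[i] is a nonnegative real element of R[i]. *)
Definition scalar_field (R : realType) (s : scalar_kind) : numFieldType :=
  match s with
  | RealScalars => R
  | ComplexScalars => R[i]%C
  end.

Lemma scalar_supremums (R : realType) (s : scalar_kind)
    (E : set (scalar_field R s)) :
  E !=set0 -> (forall x, E x -> 0 <= x) -> ubound E !=set0 ->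
  supremums E !=set0.
Proof.
case: s E => /= E [x0 Ex0] E0 [M EM].
  have hE : has_sup E by split; [exists x0 | exists M].
  exists (sup E); split; first exact: sup_upper_bound.
  by move=> y Ey; apply: ge_sup => //; exists x0.
pose F : set R := [set complex.Re z | z in E].
have hF : has_sup F.
  split; first by exists (complex.Re x0), x0.
  exists (complex.Re M) => _ [z Ez <-].
  by have := EM _ Ez; rewrite lecE => /andP[].
exists (real_complex R (sup F)); split => [z Ez|y Ey].
  have := E0 _ Ez; rewrite !lecE /= => /andP[/eqP -> _]; rewrite eqxx /=.
  by apply: sup_upper_bound => //; exists z.
have := E0 _ Ex0; have := Ey _ Ex0; rewrite !lecE /=.
move=> /andP[/eqP -> _] /andP[/eqP -> _]; rewrite eqxx /=.
apply: ge_sup; first by case: hF.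
by move=> _ [z Ez <-]; have := Ey _ Ez; rewrite lecE => /andP[].
Qed.

(* Not necessarily unital, so this cannot be built on GRing.Algebra. *)
HB.mixin Record CompleteNormedModule_isBanachAlgebra (K : numFieldType) A
    & CompleteNormedModule K A := {
  bmul : A -> A -> A;
  bmulA : associative bmul;
  bmulDl : left_distributive bmul +%R;
  bmulDr : right_distributive bmul +%R;
  bmulZl : forall (k : K) (a b : A), bmul (k *: a) b = k *: bmul a b;
  bmulZr : forall (k : K) (a b : A), bmul a (k *: b) = k *: bmul a b;
  normbM : forall a b : A, `|bmul a b| <= `|a| * `|b|
}.

#[short(type="banachAlgType")]
HB.structure Definition BanachAlgebra (K : numFieldType) :=
  {A of CompleteNormedModule K A & CompleteNormedModule_isBanachAlgebra K A}.

Section DualSpace.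
Variables (K : numFieldType) (V : normedModType K).

Definition dual_pred : {pred V -> K^o} :=
  mem [set f : V -> K^o | linear f /\ continuous f].

Record dual := Dual {
  dual_fun :> V -> K^o;
  dual_funP : dual_fun \in dual_pred
}.

HB.instance Definition _ := [isSub for dual_fun].
HB.instance Definition _ := [Choice of dual by <:].

Lemma dual_submod_closed : submod_closed dual_pred.
Proof.
split=> [|k f g].
  apply/mem_set; split=> [k x y|x]; last exact: cvg_cst.
  by rewrite -[LHS]/0 -[X in _ *: X]/0 scaler0 addr0.
rewrite !inE => -[fl fc] [gl gc]; split.
  move=> c x y; rewrite -[LHS]/(k *: f (c *: x + y) + g (c *: x + y)) fl gl.
  rewrite -[RHS]/(c *: (k *: f x + g x) + (k *: f y + g y)).
  by rewrite !scalerDr !scalerA [k * c]mulrC addrACA.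
by move=> x; apply: cvgD; [apply: cvgZr; exact: fc | exact: gc].
Qed.

HB.instance Definition _ :=
  GRing.isSubmodClosed.Build _ _ dual_pred dual_submod_closed.
HB.instance Definition _ := [SubChoice_isSubLmodule of dual by <:].

Lemma dual_linear (f : dual) : linear f.
Proof. by case: f => f /=; rewrite inE => -[]. Qed.

Lemma dual_continuous (f : dual) : continuous f.
Proof. by case: f => f /=; rewrite inE => -[]. Qed.

HB.instance Definition _ (f : dual) :=
  GRing.isLinear.Build K V K^o *:%R (dual_fun f) (dual_linear f).

Lemma dual_predP (f : V -> K^o) (M : K) :
  linear f -> (forall x, `|f x| <= M * `|x|) -> f \in dual_pred.
Proof.
move=> fl fM; rewrite inE; split=> //.
pose Lf := GRing.isLinear.Build K V K^o *:%R f fl.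
pose F : {linear V -> K^o} := HB.pack f Lf.
apply: (@bounded_linear_continuous _ _ _ F); apply/bounded_funP => r.
have M0 : 0 <= `|M| by [].
exists (`|M| * `|r|) => x xr; apply: le_trans (fM x) _.
have r0 : 0 <= r by apply: le_trans xr.
have Mr : M * `|x| \is Num.real by apply: ger0_real; apply: le_trans (fM x).
rewrite (ger0_norm r0); apply: (@le_trans _ _ (`|M| * `|x|)).
  by rewrite (le_trans (real_ler_norm Mr))// normrM normr_id.
by rewrite ler_wpM2l.
Qed.

End DualSpace.

Section DualNorm.
Variables (R : realType) (s : scalar_kind).
Notation K := (scalar_field R s).
Variable V : normedModType K.

Definition dual_norm (f : dual V) : K :=
  supremum 0 [set `|f x| | x in [set x : V | `|x| <= 1]].

Lemma dual_norm_supremums (f : dual V) :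
  supremums [set `|f x| | x in [set x : V | `|x| <= 1]] (dual_norm f).
Proof.
rewrite /dual_norm /supremum.
have E0 : [set `|f x| | x in [set x : V | `|x| <= 1]] !=set0.
  by exists `|f 0|, 0 => //=; rewrite normr0.
case: ifPn => [/eqP E|_]; first by move: E0; rewrite E => -[].
apply: xgetPex; apply: scalar_supremums => //.
  by move=> _ [x _ <-].
have /continuous_linear_bounded/bounded_funP/(_ 1)[M fM] :
    {for 0, continuous f} by exact: dual_continuous.
by exists M => _ [x x1 <-]; exact: fM.
Qed.

Lemma dual_norm_ge0 (f : dual V) : 0 <= dual_norm f.
Proof.
have [ub _] := dual_norm_supremums f; apply: (@le_trans _ _ `|f 0|) => //.
by apply: ub; exists 0 => //=; rewrite normr0.
Qed.

Lemma dual_norm_bound (f : dual V) (x : V) : `|f x| <= dual_norm f * `|x|.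
Proof.
have [->|x0] := eqVneq x 0; first by rewrite linear0 !normr0 mulr0.
have [ub _] := dual_norm_supremums f.
rewrite -ler_pdivrMr ?normr_gt0 //; apply: ub; exists (`|x|^-1 *: x).
  by rewrite /= normrZ normfV normr_id mulVf ?normr_eq0.
by rewrite linearZ /= normrM normfV normr_id mulrC.
Qed.

Lemma dual_norm_le (f : dual V) (M : K) :
  0 <= M -> (forall x, `|f x| <= M * `|x|) -> dual_norm f <= M.
Proof.
move=> M0 fM; have [_] := dual_norm_supremums f; apply=> _ [x /= x1 <-].
by apply: le_trans (fM x) _; rewrite ler_piMr.
Qed.

Lemma dual_normD (f g : dual V) :
  dual_norm (f + g) <= dual_norm f + dual_norm g.
Proof.
apply: dual_norm_le => [|x]; first by rewrite addr_ge0 ?dual_norm_ge0.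
rewrite mulrDl; apply: le_trans (ler_normD (f x) (g x)) _.
by rewrite lerD ?dual_norm_bound.
Qed.

Lemma dual_normZ (k : K) (f : dual V) :
  dual_norm (k *: f) = `|k| * dual_norm f.
Proof.
have le (c : K) (g : dual V) : dual_norm (c *: g) <= `|c| * dual_norm g.
  apply: dual_norm_le => [|x]; first by rewrite mulr_ge0 ?dual_norm_ge0.
  have -> : (c *: g) x = c * g x by [].
  by rewrite normrM -mulrA ler_wpM2l ?dual_norm_bound.
apply/eqP; rewrite eq_le le /=; have [->|k0] := eqVneq k 0.
  by rewrite normr0 mul0r dual_norm_ge0.
rewrite -ler_pdivlMl ?normr_gt0 // -normfV.
by have := le k^-1 (k *: f); rewrite scalerA mulVf // scale1r.
Qed.

Lemma dual_norm0_eq0 (f : dual V) : dual_norm f = 0 -> f = 0.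
Proof.
move=> f0; apply/val_inj/funext => x; apply/eqP; rewrite -normr_le0.
by have := dual_norm_bound f x; rewrite f0 mul0r.
Qed.

HB.instance Definition _ :=
  Lmodule_isNormed.Build K (dual V) dual_normD dual_normZ dual_norm0_eq0.

Lemma dual_bound (f : dual V) (x : V) : `|f x| <= `|f| * `|x|.
Proof. exact: dual_norm_bound. Qed.

Lemma dual_le (f : dual V) (M : K) :
  0 <= M -> (forall x, `|f x| <= M * `|x|) -> `|f| <= M.
Proof. exact: dual_norm_le. Qed.

End DualNorm.

Section Topologies.
Variables (R : realType) (s : scalar_kind).
Notation K := (scalar_field R s).
Variable V : normedModType K.

Lemma canonical_embedding_subproof (x : V) :
  (fun f : dual V => f x) \in @dual_pred K (dual V).
Proof.
apply: (@dual_predP _ _ _ `|x|) => // f.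
by rewrite mulrC dual_bound.
Qed.

Definition canonical_embedding (x : V) : dual (dual V) :=
  Dual (canonical_embedding_subproof x).

(* sigma(V, V^* ) *)
Definition weak : Type :=
  initial_topology (fun (x : V) => (fun f : dual V => f x) : {ptws dual V -> K^o}).
HB.instance Definition _ := Topological.on weak.

(* sigma(V^*, V) *)
Definition weak_star : Type :=
  initial_topology (fun (f : dual V) => (f : V -> K^o) : {ptws V -> K^o}).
HB.instance Definition _ := Topological.on weak_star.

End Topologies.

Section Arens.
Variables (R : realType) (s : scalar_kind).
Notation K := (scalar_field R s).
Variable A : banachAlgType K.

Notation "A ^*1" := (dual A) (at level 2, format "A ^*1").
Notation "A ^*2" := (dual (dual A)) (at level 2, format "A ^*2").
Notation "A ^*3" := (dual (dual (dual A))) (at level 2, format "A ^*3").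

(* a' a, where <a' a, b> = <a', a b> *)
Lemma dual_act_subproof (a' : A^*1) (a : A) :
  (fun b : A => a' (bmul a b)) \in @dual_pred K A.
Proof.
apply: (@dual_predP _ _ _ (`|a'| * `|a|)) => [k x y|x].
  by rewrite bmulDr bmulZr linearP.
by rewrite (le_trans (dual_bound _ _))// -mulrA ler_wpM2l ?normbM.
Qed.

Definition dual_act (a' : A^*1) (a : A) : A^*1 := Dual (dual_act_subproof a' a).

Lemma dual_act_le (a' : A^*1) (a : A) : `|dual_act a' a| <= `|a'| * `|a|.
Proof.
apply: dual_le => [|x]; first by rewrite mulr_ge0.
by rewrite /= (le_trans (dual_bound _ _))// -mulrA ler_wpM2l ?normbM.
Qed.

(* a'' a', where <a'' a', a> = <a'', a' a> *)
Lemma bidual_act_subproof (a'' : A^*2) (a' : A^*1) :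
  (fun a : A => a'' (dual_act a' a)) \in @dual_pred K A.
Proof.
apply: (@dual_predP _ _ _ (`|a''| * `|a'|)) => [k x y|x].
  rewrite /= -linearP; congr (a'' _); apply/val_inj/funext => b /=.
  by rewrite bmulDl bmulZl linearP.
by rewrite (le_trans (dual_bound _ _))// -mulrA ler_wpM2l ?dual_act_le.
Qed.

Definition bidual_act (a'' : A^*2) (a' : A^*1) : A^*1 :=
  Dual (bidual_act_subproof a'' a').

Lemma bidual_act_le (a'' : A^*2) (a' : A^*1) :
  `|bidual_act a'' a'| <= `|a''| * `|a'|.
Proof.
apply: dual_le => [|x]; first by rewrite mulr_ge0.
by rewrite /= (le_trans (dual_bound _ _))// -mulrA ler_wpM2l ?dual_act_le.
Qed.

(* The first Arens product a'' b'', where <a'' b'', a'> = <a'', b'' a'> *)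
Lemma arens_subproof (a'' b'' : A^*2) :
  (fun a' : A^*1 => a'' (bidual_act b'' a')) \in @dual_pred K A^*1.
Proof.
apply: (@dual_predP _ _ _ (`|a''| * `|b''|)) => [k x y|x].
  rewrite /= -linearP; congr (a'' _); apply/val_inj/funext => b /=.
  rewrite -[RHS]/(k *: b'' (dual_act x b) + b'' (dual_act y b)) -linearP.
  by congr (b'' _); apply/val_inj/funext.
by rewrite (le_trans (dual_bound _ _))// -mulrA ler_wpM2l ?bidual_act_le.
Qed.

Definition arens (a'' b'' : A^*2) : A^*2 := Dual (arens_subproof a'' b'').

Lemma arens_le (a'' b'' : A^*2) : `|arens a'' b''| <= `|a''| * `|b''|.
Proof.
apply: dual_le => [|x]; first by rewrite mulr_ge0.
by rewrite /= (le_trans (dual_bound _ _))// -mulrA ler_wpM2l ?bidual_act_le.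
Qed.

Lemma arensPl (k : K) (a'' b'' c'' : A^*2) :
  arens (k *: a'' + b'') c'' = k *: arens a'' c'' + arens b'' c''.
Proof. by apply/val_inj/funext. Qed.

Lemma arensPr (k : K) (a'' b'' c'' : A^*2) :
  arens a'' (k *: b'' + c'') = k *: arens a'' b'' + arens a'' c''.
Proof.
apply/val_inj/funext => a' /=.
have -> : bidual_act (k *: b'' + c'') a' =
  k *: bidual_act b'' a' + bidual_act c'' a' by apply/val_inj/funext.
exact: linearP.
Qed.

(* a''' a'', where <a''' a'', b''> = <a''', a'' b''> *)
Lemma tridual_ract_subproof (a''' : A^*3) (a'' : A^*2) :
  (fun b'' : A^*2 => a''' (arens a'' b'')) \in @dual_pred K A^*2.
Proof.
apply: (@dual_predP _ _ _ (`|a'''| * `|a''|)) => [k x y|x].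
  by rewrite arensPr linearP.
by rewrite (le_trans (dual_bound _ _))// -mulrA ler_wpM2l ?arens_le.
Qed.

Definition tridual_ract (a''' : A^*3) (a'' : A^*2) : A^*3 :=
  Dual (tridual_ract_subproof a''' a'').

(* a'' a''', where <a'' a''', b''> = <a''', b'' a''> *)
Lemma tridual_lact_subproof (a'' : A^*2) (a''' : A^*3) :
  (fun b'' : A^*2 => a''' (arens b'' a'')) \in @dual_pred K A^*2.
Proof.
apply: (@dual_predP _ _ _ (`|a'''| * `|a''|)) => [k x y|x].
  by rewrite arensPl linearP.
rewrite (le_trans (dual_bound _ _))// -mulrA ler_wpM2l //.
by rewrite mulrC arens_le.
Qed.

Definition tridual_lact (a'' : A^*2) (a''' : A^*3) : A^*3 :=
  Dual (tridual_lact_subproof a'' a''').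

Definition Z1 : set A^*2 := [set a'' |
  continuous ((fun b'' => arens a'' b'') : weak_star A^*1 -> weak_star A^*1)].

Definition Z1l : set A^*2 := [set a'' |
  continuous ((fun b'' => arens a'' b'') : weak_star A^*1 -> weak A^*2)].

Definition Z1r : set A^*2 := [set a'' |
  continuous ((fun b'' => arens b'' a'') : weak_star A^*1 -> weak A^*2)].

End Arens.

Arguments Z1 {R s} A.
Arguments Z1l {R s} A.
Arguments Z1r {R s} A.

(* Main.v *)
Require Import Defs.
From mathcomp Require Import all_boot all_order all_algebra.
From mathcomp Require Import all_classical all_reals all_analysis.
Local Open Scope classical_set_scope.

(** Both topologies are initial, so continuity can be tested one functional at
    a time.  The weak* topology on the bidual is generated by the evaluations
    at elements of the dual, that is by the functionals [canonical_embedding a'];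
    the weak topology is generated by all functionals [a'''].  Composing
    [a'''] with left multiplication by [a''] gives the functional
    [tridual_ract a''' a''], and composing it with right multiplication gives
    [tridual_lact a'' a'''].  When these functionals come from the dual, they are
    weak*-continuous, and hence the multiplications are weak*-to-weak
    continuous ([continuous_to_weak]).  Since every [canonical_embedding a'] is
    one of the [a'''], the weak topology is finer than the weak* topology, and
    weak*-to-weak continuity implies weak*-to-weak* continuity. *)

Lemma continuous_ptws {X V : topologicalType} {U : Type}
    (F : X -> {ptws U -> V}) :
  (forall u, continuous (fun x => F x u)) -> continuous F.
Proof.
move=> Fc x; apply/cvg_sup => u; move: x.
exact: (@continuous_comp_initial _ X V (fun f : {ptws U -> V} => f u) F (Fc u)).
Qed.

Lemma ptws_evaluation_continuous {V : topologicalType} {U : Type} (u : U) :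
  continuous (fun f : {ptws U -> V} => f u).
Proof.
move=> f.
have /cvg_sup/(_ u) fu : nbhs f --> f by apply: cvg_id.
by move=> B /(@initial_continuous _ _ (fun g : {ptws U -> V} => g u)) /fu.
Qed.

Section WeakTopologies.
Context {R : realType} {s : scalar_kind}.
Notation K := (scalar_field R s).
Context {V : normedModType K}.

Lemma continuous_to_weak {X : topologicalType} (F : X -> weak V) :
  (forall f : dual V, continuous (fun x => f (F x) : K^o)) -> continuous F.
Proof. by move=> Fc; apply/continuous_comp_initial/continuous_ptws. Qed.

Lemma continuous_to_weak_star {X : topologicalType} (F : X -> weak_star V) :
  (forall v : V, continuous (fun x => (F x : dual V) v : K^o)) -> continuous F.
Proof. by move=> Fc; apply/continuous_comp_initial/continuous_ptws. Qed.

Lemma weak_functional_continuous (f : dual V) :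
  continuous (fun v : weak V => f v : K^o).
Proof.
move=> v; apply: (@continuous_comp (weak V) _ _
  (fun w : V => (fun h : dual V => h w) : {ptws dual V -> K^o})
  (fun g : {ptws dual V -> K^o} => g f)); first exact: initial_continuous.
exact: ptws_evaluation_continuous.
Qed.

Lemma weak_star_evaluation_continuous (v : V) :
  continuous (fun f : weak_star V => (f : dual V) v : K^o).
Proof.
move=> f; apply: (@continuous_comp (weak_star V) _ _
  (fun h : dual V => (h : V -> K^o) : {ptws V -> K^o})
  (fun g : {ptws V -> K^o} => g v)); first exact: initial_continuous.
exact: ptws_evaluation_continuous.
Qed.

(** A functional on the dual that comes from [V] is an evaluation, so it is
    weak*-continuous. *)
Lemma range_canonical_embedding_continuous (phi : dual (dual V)) :
  range (@canonical_embedding R s V) phi ->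
  continuous (fun f : weak_star V => phi f : K^o).
Proof. by move=> [v _ <-]; exact: weak_star_evaluation_continuous. Qed.

End WeakTopologies.

(** Each weak* generator [canonical_embedding v] is a weak generator. *)
Lemma continuous_weak_weak_star {R : realType} {s : scalar_kind}
    {V : normedModType (scalar_field R s)} {X : topologicalType}
    (F : X -> dual V) :
  continuous (F : X -> weak (dual V)) -> continuous (F : X -> weak_star V).
Proof.
move=> Fc; apply: continuous_to_weak_star => v x.
apply: (@continuous_comp _ _ _ (F : X -> weak (dual V))
  (fun f => (f : dual V) v : (scalar_field R s)^o)); first exact: Fc.
exact: (weak_functional_continuous (canonical_embedding v)).
Qed.

Theorem mainTheorem1 (R : realType) (s : scalar_kind)
    (A : banachAlgType (scalar_field R s)) :
  ([set tridual_ract a''' a'' | a''' in [set: dual (dual (dual A))]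
                              & a'' in [set: dual (dual A)]]
     `<=` range (@canonical_embedding R s (dual A)) ->
   Z1l A = Z1 A /\ Z1 A = [set: dual (dual A)]) /\
  ([set tridual_lact a'' a''' | a'' in [set: dual (dual A)]
                              & a''' in [set: dual (dual (dual A))]]
     `<=` range (@canonical_embedding R s (dual A)) ->
   Z1r A = [set: dual (dual A)]).
Proof.
split=> [ractA|lactA].
  have Z1lT : Z1l A = setT.
    apply/seteqP; split=> // a'' _; apply: continuous_to_weak => a'''.
    apply: (range_canonical_embedding_continuous (tridual_ract a''' a'')).
    by apply: ractA; exists a''' => //; exists a''.
  have Z1T : Z1 A = setT.
    apply/seteqP; split=> // a'' _; apply: continuous_weak_weak_star.
    by have : Z1l A a'' by rewrite Z1lT.
  by rewrite Z1lT Z1T.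
apply/seteqP; split=> // a'' _; apply: continuous_to_weak => a'''.
apply: (range_canonical_embedding_continuous (tridual_lact a'' a''')).
by apply: lactA; exists a'' => //; exists a'''.
Qed.
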